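(* Let $L,M\ge 1$. Let $B\in\{1,\dots,L\}$ be the oracle label with prior probabilities $\rho_j=\mathbb{P}(B=j)$, and let $D=(D_1,\dots,D_M)\in\{1,\dots,L\}^M$ be local recommendations that are conditionally independent given $B$ with recommendation channels $Q_m(a\mid j)=\mathbb{P}(D_m=a\mid B=j)$, that is, $\mathbb{P}(D=d\mid B=j)=\prod_{m=1}^M Q_m(d_m\mid j)$ for all $d$ and $j$. Let $C(i,j)$, $1\le i,j\le L$, be a loss matrix with $C(i,j)\ge 0$ and $C(j,j)=0$. Then the Bayes-optimal fusion rule for the loss $C$ is $$\delta_C^*(d_1,\dots,d_M)=\arg\min_{1\le i\le L}\ \sum_{j=1}^L C(i,j)\,\rho_j\prod_{m=1}^M Q_m(d_m\mid j),$$ i.e. any map $\delta_C^*:\{1,\dots,L\}^M\to\{1,\dots,L\}$ choosing, for each $d$, a minimizer of this expression minimizes the Bayes risk $\mathbb{E}\left[C(\delta(D),B)\right]$ over all fusion rules $\delta:\{1,\dots,L\}^M\to\{1,\dots,L\}$.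
   Context: $B=j$ means that experiment $\xi_j$, among finitely many candidates $\xi_1,\dots,\xi_L$, is the one a centralized oracle would select; $D_m$ is the index of the experiment recommended by agent $m$; $C(i,j)$ is the real-valued loss incurred by selecting $\xi_i$ when the oracle design is $\xi_j$. We have $\rho_j\ge 0$, $\sum_{j=1}^L\rho_j=1$, and for each $m$ and $j$, $Q_m(a\mid j)\ge 0$, $\sum_{a=1}^L Q_m(a\mid j)=1$; the joint law is $\mathbb{P}(B=j,D=d)=\rho_j\prod_{m=1}^M Q_m(d_m\mid j)$. A fusion rule is a map $\delta:\{1,\dots,L\}^M\to\{1,\dots,L\}$. Ties in the argmin may be broken arbitrarily. *)

(* Defs.v *)
(* Labels are ['I_L], agents are ['I_M], and a vector of recommendations
   d = (d_1, ..., d_M) is a [{ffun 'I_M -> 'I_L}]. *)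
From HB Require Import structures.
From mathcomp Require Import all_boot all_order all_algebra.
From mathcomp Require Import all_classical all_reals all_analysis.

Set Implicit Arguments.
Unset Strict Implicit.
Unset Printing Implicit Defensive.

Import Order.TTheory GRing.Theory Num.Theory.

Local Open Scope classical_set_scope.
Local Open Scope ring_scope.

(* Measurability for the discrete sigma-algebra on [T]. The bundled type
   [{RV P >-> T}] would need ['I_L] to be pointed, hence [L] a successor. *)
Definition finite_rv d (Om : measurableType d) (T : finType) (X : Om -> T) :=
  forall t : T, measurable (X @^-1` [set t]).

(* Only meaningful when [P E != 0]; the value is 0 otherwise. *)
Definition cprob d (Om : measurableType d) (R : realType)
    (P : probability Om R) (A E : set Om) : R :=
  fine (P (A `&` E)) / fine (P E).

Definition recs (Om : Type) (L M : nat) (D : 'I_M -> Om -> 'I_L) (w : Om) :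
  {ffun 'I_M -> 'I_L} := [ffun m => D m w].

(* [Q m a j] is Q_m(a | j). Conditioning on [B = j] is required to agree with
   [Q] only when [B = j] has nonzero probability; lemma
   [recommendation_modelP] below shows that the conditions amount to
   prescribing the joint law of [(B, D)], null labels included, with [rho] a
   probability vector. *)
Record recommendation_model d (Om : measurableType d) (R : realType)
    (P : probability Om R) (L M : nat) (B : Om -> 'I_L)
    (D : 'I_M -> Om -> 'I_L) (rho : 'I_L -> R) (Q : 'I_M -> 'I_L -> 'I_L -> R)
    : Prop := RecommendationModel {
  oracle_rv : finite_rv B ;
  recommendation_rv : forall m, finite_rv (D m) ;
  prior : forall j, P (B @^-1` [set j]) = (rho j)%:E ;
  channel_ge0 : forall m a j, 0 <= Q m a j ;
  channel_sum1 : forall m j, \sum_(a < L) Q m a j = 1 ;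
  channelE : forall m a j, rho j != 0 ->
    cprob P (D m @^-1` [set a]) (B @^-1` [set j]) = Q m a j ;
  conditional_independence : forall (dd : {ffun 'I_M -> 'I_L}) j, rho j != 0 ->
    cprob P (recs D @^-1` [set dd]) (B @^-1` [set j]) =
    \prod_(m < M) Q m (dd m) j }.

Definition fusion_rule (L M : nat) := {ffun 'I_M -> 'I_L} -> 'I_L.

Definition bayes_risk d (Om : measurableType d) (R : realType)
    (P : probability Om R) (L M : nat) (B : Om -> 'I_L)
    (D : 'I_M -> Om -> 'I_L) (C : 'I_L -> 'I_L -> R)
    (delta : fusion_rule L M) : \bar R :=
  ('E_P[fun w => C (delta (recs D w)) (B w)])%E.

Definition fusion_score (R : realType) (L M : nat) (C : 'I_L -> 'I_L -> R)
    (rho : 'I_L -> R) (Q : 'I_M -> 'I_L -> 'I_L -> R)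
    (dd : {ffun 'I_M -> 'I_L}) (i : 'I_L) : R :=
  \sum_(j < L) C i j * rho j * \prod_(m < M) Q m (dd m) j.

Definition is_argmin_fusion (R : realType) (L M : nat) (C : 'I_L -> 'I_L -> R)
    (rho : 'I_L -> R) (Q : 'I_M -> 'I_L -> 'I_L -> R)
    (delta : fusion_rule L M) : Prop :=
  forall dd i, fusion_score C rho Q dd (delta dd) <= fusion_score C rho Q dd i.

Definition bayes_optimal d (Om : measurableType d) (R : realType)
    (P : probability Om R) (L M : nat) (B : Om -> 'I_L)
    (D : 'I_M -> Om -> 'I_L) (C : 'I_L -> 'I_L -> R)
    (delta : fusion_rule L M) : Prop :=
  forall delta', (bayes_risk P B D C delta <= bayes_risk P B D C delta')%E.

Section recommendations.
Context d (Om : measurableType d) (R : realType) (P : probability Om R).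

Lemma finite_rvI (T : finType) (X : Om -> T) (p : pred T) :
  finite_rv X -> measurable (X @^-1` [set t | p t]).
Proof.
move=> mX; have -> : X @^-1` [set t | p t] =
    \bigcup_(t in [set t | p t]) X @^-1` [set t].
  by apply/seteqP; split=> [w pw|w [t /= pt ->]] //; exists (X w).
by apply: fin_bigcup_measurable => // t _; exact: mX.
Qed.

Lemma prob_partition (T : finType) (X : Om -> T) (E : set Om) :
  finite_rv X -> measurable E ->
  P E = (\sum_(t : T) P (E `&` X @^-1` [set t]))%E.
Proof.
move=> mX mE; have {1}-> : E = \bigcup_(t in [set: T]) (E `&` X @^-1` [set t]).
  by apply/seteqP; split=> [w Ew|w [t _ []]] //; exists (X w).
rewrite measure_fin_bigcup //; first last.
- by move=> t _; apply: measurableI => //; exact: mX.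
- by move=> s t _ _ [w [[_ /= <-] [_ /= <-]]].
- exact: finite_finset.
rewrite [RHS]fsbig_seq ?index_enum_uniq //.
by congr (\sum_(t \in _) _)%E; apply/seteqP; split=> t //= _; rewrite mem_index_enum.
Qed.

Context (L M : nat) (B : Om -> 'I_L) (D : 'I_M -> Om -> 'I_L).

Lemma finite_rv_recs : (forall m, finite_rv (D m)) -> finite_rv (recs D).
Proof.
move=> mD dd; have -> : recs D @^-1` [set dd] =
    \bigcap_(m in [set: 'I_M]) (D m @^-1` [set dd m]).
  apply/seteqP; split=> [w /= <- m _ /=|w /= h]; first by rewrite ffunE.
  by apply/ffunP => m; rewrite ffunE; exact: h.
by apply: fin_bigcap_measurable => // m _; exact: mD.
Qed.

Context (rho : 'I_L -> R) (Q : 'I_M -> 'I_L -> 'I_L -> R).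

Definition joint_law : Prop := forall j dd,
  P (B @^-1` [set j] `&` recs D @^-1` [set dd]) =
  (rho j * \prod_(m < M) Q m (dd m) j)%:E.

Lemma joint_lawE (p : pred {ffun 'I_M -> 'I_L}) j :
  finite_rv B -> (forall m, finite_rv (D m)) -> joint_law ->
  P (recs D @^-1` [set dd | p dd] `&` B @^-1` [set j]) =
  (rho j * \sum_(dd | p dd) \prod_(m < M) Q m (dd m) j)%:E.
Proof.
move=> mB mD PBD; have mr := finite_rv_recs mD.
rewrite (prob_partition mr); last first.
  by apply: measurableI; [exact: finite_rvI|exact: mB].
rewrite mulr_sumr -sumEFin [RHS]big_mkcond /=; apply: eq_bigr => dd _.
case: ifPn => pd.
  rewrite -PBD; congr (P _); apply/seteqP; split=> w /=.
    by case=> [[_ ?] ?].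
  by case=> ? e; split => //; rewrite e.
rewrite -[RHS](measure0 P); congr (P _); apply/seteqP; split=> w //= [[+ _] e].
by rewrite e (negbTE pd).
Qed.

Lemma recommendation_modelP :
  recommendation_model P B D rho Q <->
  [/\ finite_rv B /\ (forall m, finite_rv (D m)),
      (forall j, 0 <= rho j) /\ \sum_(j < L) rho j = 1,
      (forall m a j, 0 <= Q m a j) /\ (forall m j, \sum_(a < L) Q m a j = 1) &
      joint_law].
Proof.
split=> [[mB mD hrho Q0 Q1 _ hd]|[[mB mD] [rho0 rho1] [Q0 Q1] PBD]].
- have mr := finite_rv_recs mD; split => //.
  + split=> [j|]; first by rewrite -lee_fin -hrho measure_ge0.
    apply: EFin_inj; rewrite -sumEFin -(@probability_setT _ _ _ P).
    rewrite (prob_partition mB) //; apply: eq_bigr => j _.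
    by rewrite setTI hrho.
  + move=> j dd.
    have mBr : measurable (B @^-1` [set j] `&` recs D @^-1` [set dd]).
      by apply: measurableI; [exact: mB|exact: mr].
    have [rj0|rj0] := eqVneq (rho j) 0.
      rewrite rj0 mul0r; apply/eqP; rewrite eq_le measure_ge0 andbT.
      have <- : P (B @^-1` [set j]) = 0%:E by rewrite hrho rj0.
      by apply: le_measure; rewrite ?inE //; exact: mB.
    rewrite -(hd dd j rj0) /cprob hrho /= mulrC divfK // setIC fineK //.
    by rewrite setIC; apply: fin_num_measure.
- have PB j : P (B @^-1` [set j]) = (rho j)%:E.
    have := joint_lawE xpredT j mB mD PBD.
    have -> : [set dd : {ffun 'I_M -> 'I_L} | xpredT dd] = setT.
      by apply/seteqP; split.
    rewrite preimage_setT setTI => ->.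
    by rewrite -(bigA_distr_bigA (fun m a => Q m a j)) big1 ?mulr1.
  have cprobE (p : pred {ffun 'I_M -> 'I_L}) j : rho j != 0 ->
      cprob P (recs D @^-1` [set dd | p dd]) (B @^-1` [set j]) =
      \sum_(dd | p dd) \prod_(m < M) Q m (dd m) j.
    move=> rj0; rewrite /cprob (joint_lawE p j mB mD PBD) PB /=.
    by rewrite mulrAC mulfV // mul1r.
  split => //.
  + move=> m a j rj0; have := cprobE (fun dd => dd m == a) j rj0.
    have -> : recs D @^-1` [set dd | dd m == a] = D m @^-1` [set a].
      by apply/seteqP; split=> w /=; rewrite ffunE => /eqP.
    move=> ->; rewrite big_mkcond /=.
    transitivity (\sum_(dd : {ffun 'I_M -> 'I_L})
        \prod_(k < M) (if (k == m) && (dd k != a) then 0 else Q k (dd k) j)).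
      apply: eq_bigr => dd _; case: ifPn => ha.
        apply: eq_bigr => k _; case: eqVneq => [->|//].
        by rewrite ha.
      by rewrite (bigD1 m) //= eqxx ha mul0r.
    rewrite -(bigA_distr_bigA
      (fun k b => if (k == m) && (b != a) then 0 else Q k b j)).
    rewrite (bigD1 m) //= (bigD1 a) //= !eqxx /= big1 => [|b ba]; last first.
      by rewrite ba.
    rewrite addr0 big1 ?mulr1 // => k km.
    by rewrite (negbTE km) /= Q1.
  + move=> dd j rj0; have := cprobE (pred1 dd) j rj0.
    have -> : [set x | pred1 dd x] = [set dd].
      by apply/seteqP; split=> x /= /eqP.
    by move=> ->; rewrite big_pred1_eq.
Qed.

End recommendations.

(* Main.v *)
(* The Bayes risk of a fusion rule is the sum over d of its score at d, and the
   term at d depends on the rule only through its value at d. *)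
Require Import Defs.
From mathcomp Require Import all_boot all_order all_algebra.
From mathcomp Require Import all_classical all_reals all_analysis.
From mathcomp Require Import measurable_realfun.

Import Order.TTheory GRing.Theory Num.Theory.

Local Open Scope classical_set_scope.
Local Open Scope ring_scope.

(** The term [fusion_score C rho Q dd i] is the posterior expected loss of choosing [i] after seeing
    [dd], left unnormalised by the probability of [dd]. Since a fusion rule may choose its value at
    each [dd] independently, minimizing every term minimizes the sum. The work is in [bayes_riskE],
    which turns the abstract expectation into this sum through [expectation_finite_rv] and the joint
    law given by [recommendation_modelP]. *)

Lemma finite_rv_pair (d : measure_display) (Om : measurableType d)
    (S T : finType) (X : Om -> S) (Y : Om -> T) :
  finite_rv X -> finite_rv Y -> finite_rv (fun w => (X w, Y w)).
Proof.
move=> mX mY [s t].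
have -> : (fun w => (X w, Y w)) @^-1` [set (s, t)] =
    X @^-1` [set s] `&` Y @^-1` [set t].
  by apply/seteqP; split=> w /= [-> ->].
by apply: measurableI; [exact: mX|exact: mY].
Qed.

(** [f \o X] is a finite combination of indicators of the fibres of [X]; nonnegativity of [f] lets
    sum and integral be exchanged with no integrability argument. *)
Lemma expectation_finite_rv (d : measure_display) (Om : measurableType d)
    (R : realType) (P : probability Om R) (T : finType) (X : Om -> T)
    (f : T -> R) :
  finite_rv X -> (forall t, 0 <= f t) ->
  ('E_P[f \o X] = \sum_(t : T) (f t)%:E * P (X @^-1` [set t]))%E.
Proof.
move=> mX f0; rewrite unlock.
transitivity (\int[P]_w \sum_(t : T) (f t)%:E * (\1_(X @^-1` [set t]) w)%:E)%E.
  apply: eq_integral => w _.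
  (* At [w], only the fibre over [X w] contributes. *)
  rewrite (bigD1 (X w)) //= indicE mem_set // mule1 big1 ?adde0 // => t tX.
  by rewrite indicE memNset ?mule0 //= => e; rewrite e eqxx in tX.
have mI t : measurable_fun [set: Om]
    (EFin \o (\1_(X @^-1` [set t]) : Om -> R)).
  by apply/measurable_EFinP; exact: measurable_indic (mX t).
rewrite ge0_integral_sum //; first last.
- by move=> t w _; rewrite mule_ge0 // lee_fin.
- by move=> t; apply: measurable_funeM; exact: mI.
apply: eq_bigr => t _; rewrite ge0_integralZl_EFin //; last exact: mI.
by rewrite integral_indic // ?setIT //; exact: mX.
Qed.

(** The loss is a function of the finite-valued pair [(recs D w, B w)], whose law is [joint_law].
    Using the joint law rather than conditional probabilities avoids a separate case for labels with
    [rho j = 0]. *)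
Lemma bayes_riskE (d : measure_display) (Om : measurableType d) (R : realType)
    (P : probability Om R) (L M : nat) (B : Om -> 'I_L)
    (D : 'I_M -> Om -> 'I_L) (rho : 'I_L -> R) (Q : 'I_M -> 'I_L -> 'I_L -> R)
    (C : 'I_L -> 'I_L -> R) (delta : fusion_rule L M) :
  recommendation_model P B D rho Q -> (forall i j, 0 <= C i j) ->
  bayes_risk P B D C delta =
  (\sum_(dd : {ffun 'I_M -> 'I_L}) fusion_score C rho Q dd (delta dd))%:E.
Proof.
move=> /recommendation_modelP[[mB mD] _ _ PBD] C0.
have mX := finite_rv_pair _ _ _ _ _ _ (finite_rv_recs mD) mB.
rewrite /bayes_risk.
rewrite (expectation_finite_rv _ _ _ P _ _ (fun t => C (delta t.1) t.2) mX) //.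
(* The double sum over [dd] and [j] becomes one sum over the values of the pair. *)
rewrite /fusion_score pair_bigA -sumEFin; apply: eq_bigr => -[dd j] _ /=.
rewrite -mulrA EFinM -PBD; congr (_ * P _)%E.
by apply/seteqP; split=> w /= [-> ->].
Qed.

Theorem theorem2 (R : realType) (L M : nat) (L_ge1 : (1 <= L)%N)
  (M_ge1 : (1 <= M)%N)
  (disp : measure_display) (Om : measurableType disp) (P : probability Om R)
  (B : Om -> 'I_L) (D : 'I_M -> Om -> 'I_L)
  (rho : 'I_L -> R) (Q : 'I_M -> 'I_L -> 'I_L -> R)
  (model : recommendation_model P B D rho Q)
  (C : 'I_L -> 'I_L -> R)
  (C_ge0 : forall i j, 0 <= C i j) (C_diag : forall j, C j j = 0)
  (delta : fusion_rule L M) (delta_argmin : is_argmin_fusion C rho Q delta) :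
  bayes_optimal P B D C delta.
Proof.
(* Both risks are finite, so the comparison takes place in [R]. *)
move=> delta'; rewrite !(bayes_riskE _ _ _ _ _ _ _ _ _ _ _ _ model C_ge0) lee_fin.
by apply: ler_sum => dd _; exact: delta_argmin.
Qed.
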